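(* For each integer $k\geq 3$ and each integer $r$ with $1\leq r\leq k-1$, there exists a graph $G_{k,r}$ such that $\Gamma(G_{k,r})=k$, $\gamma(G_{k,r})=r+1$ and $d_0(G_{k,r})=k+r=\Gamma(G_{k,r})+\gamma(G_{k,r})-1$.
   Context: All graphs are finite and simple. For a graph $G$, $\gamma(G)$ is the domination number (minimum cardinality of a dominating set) and $\Gamma(G)$ is the upper domination number (maximum cardinality of a minimal dominating set). For an integer $k$, the $k$-dominating graph $D_k(G)$ has as vertices the dominating sets of $G$ of cardinality at most $k$, two such sets being adjacent if and only if one can be obtained from the other by adding or deleting a single vertex of $G$. $d_0(G)$ denotes the smallest integer such that $D_k(G)$ is connected for all $k\geq d_0(G)$. *)

(* Defs.v *)
From mathcomp Require Import all_boot.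

Set Implicit Arguments.
Unset Strict Implicit.
Unset Printing Implicit Defensive.

Record sgraph := SGraph {
  vertex :> finType;
  adj : rel vertex;
  adj_sym : symmetric adj;
  adj_irrefl : irreflexive adj
}.

(* The graph without vertices is not connected, so that D_k(G) is not connected
   when k is below the domination number; in particular it is harmless to let k
   range over nat only in is_d0. *)
Definition connected (G : sgraph) : bool :=
  (0 < #|G|) && [forall x : G, forall y : G, connect (@adj G) x y].

Definition dominating (G : sgraph) (D : {set G}) : bool :=
  [forall v : G, (v \notin D) ==> [exists u in D, adj u v]].

(* The default [set: G] of the argmin is itself dominating. *)
Definition gamma (G : sgraph) : nat :=
  #|[arg min_(D < [set: G] | dominating D) #|D|]|.

Definition Gamma (G : sgraph) : nat :=
  \max_(D : {set G} | minset (@dominating G) D) #|D|.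

Definition dom_vertex (k : nat) (G : sgraph) : finType :=
  {D : {set G} | dominating D && (#|D| <= k)}.

Definition dom_adj (k : nat) (G : sgraph) : rel (dom_vertex k G) :=
  fun A B => [exists v : G,
    ((v \notin val A) && (val B == v |: val A))
    || ((v \in val A) && (val B == val A :\ v))].

Lemma dom_adj_sym (k : nat) (G : sgraph) : symmetric (@dom_adj k G).
Proof.
suff imp A B : @dom_adj k G A B -> dom_adj B A.
  by move=> A B; apply/idP/idP; apply: imp.
case/existsP=> v /orP[] /andP[vA /eqP eB]; apply/existsP; exists v; rewrite eB.
  by rewrite setU11 setU1K ?eqxx ?orbT.
by rewrite setD11 setD1K ?eqxx.
Qed.

Lemma dom_adj_irrefl (k : nat) (G : sgraph) : irreflexive (@dom_adj k G).
Proof.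
move=> A; apply/negbTE/negP => /existsP[v] /orP[] /andP[vA /eqP eA]; move: vA.
  by rewrite eA setU11.
by rewrite eA setD11.
Qed.

Definition dom_graph (k : nat) (G : sgraph) : sgraph :=
  SGraph (@dom_adj_sym k G) (@dom_adj_irrefl k G).

(* is_d0 G d means d_0(G) = d. *)
Definition is_d0 (G : sgraph) (d : nat) : Prop :=
  (forall k, d <= k -> connected (dom_graph k G)) /\
  (forall d', (forall k, d' <= k -> connected (dom_graph k G)) -> d <= d').

(* Main.v *)
(** Take a clique on [x_1, ..., x_k, w] and [r] further cliques (the columns)
    [y_1j, ..., y_kj], and join [x_i] to every [y_ij].  The neighbours of [w]
    force a dominating set to meet the first clique, and [y_ij] is dominated
    only by [x_i] or by column [j]; so a dominating set contains
    [X = {x_1, ..., x_k}] or meets every column.  Hence the minimal dominating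
    sets are [X] and the [(r+1)]-sets with one vertex in each of the [r+1]
    cliques.  Starting from [X], no vertex of [X] can be dropped before all [r]
    columns are met, which takes [k + r] vertices; conversely [k + r] vertices
    leave room for the union of any two consecutive sets along a path between
    minimal dominating sets. *)
Require Import Defs.
From mathcomp Require Import all_boot.

Set Implicit Arguments.
Unset Strict Implicit.
Unset Printing Implicit Defensive.

(** * Dominating sets and paths in the k-dominating graph of an arbitrary graph *)

Lemma subset_dominating (G : sgraph) (A B : {set G}) :
  A \subset B -> dominating A -> dominating B.
Proof.
move=> sAB /forallP domA; apply/forallP=> v; apply/implyP=> vB.
have vA : v \notin A by apply: contra vB; apply: (subsetP sAB).
have /existsP[u /andP[uA uv]] := implyP (domA v) vA.
by apply/existsP; exists u; rewrite (subsetP sAB).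
Qed.

Lemma dominating_setT (G : sgraph) : dominating [set: G].
Proof. by apply/forallP=> v; rewrite inE. Qed.

Lemma gamma_le (G : sgraph) (D : {set G}) : dominating D -> gamma G <= #|D|.
Proof.
rewrite /gamma; case: arg_minnP; first exact: dominating_setT.
by move=> A _ minA /minA.
Qed.

Lemma gamma_witness (G : sgraph) :
  exists2 D : {set G}, dominating D & gamma G = #|D|.
Proof.
rewrite /gamma; case: arg_minnP; first exact: dominating_setT.
by move=> A domA _; exists A.
Qed.

Definition dom_set (m : nat) (G : sgraph) (A : {set G})
    (domA : dominating A) (leA : #|A| <= m) : dom_graph m G :=
  exist (fun D : {set G} => dominating D && (#|D| <= m)) A
    (introT andP (conj domA leA)).

Lemma dom_connect_sym (m : nat) (G : sgraph) :
  connect_sym (@adj (dom_graph m G)).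
Proof. exact/sym_connect_sym/dom_adj_sym. Qed.

(** Add the vertices of [B] missing from [A] one at a time: each intermediate set contains [A], so
    it dominates, and lies in [B], so it has at most [m] elements. *)
Lemma dom_connect_subset (m : nat) (G : sgraph) (A B : dom_graph m G) :
  val A \subset val B -> connect (@adj (dom_graph m G)) A B.
Proof.
have [n] := ubnP #|val B :\: val A|; elim: n A => // n IHn A ltn sAB.
have [|/set0Pn[v]] := boolP (val B :\: val A == set0).
  rewrite setD_eq0 => sBA; have -> // : A = B.
  by apply/val_inj/eqP; rewrite eqEsubset sAB.
rewrite inE => /andP[vA vB].
have /andP[domA _] := valP A; have /andP[_ leB] := valP B.
have sA'B : v |: val A \subset val B by rewrite subUset sub1set vB.
have domA' : dominating (v |: val A).
  exact: subset_dominating (subsetUr _ _) domA.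
pose A' := dom_set domA' (leq_trans (subset_leq_card sA'B) leB).
apply: (connect_trans (y := A')).
  by apply/connect1/existsP; exists v; rewrite vA eqxx.
apply: IHn => //; rewrite -ltnS; apply: leq_trans ltn; rewrite ltnS.
apply/proper_card/properP; split; first by rewrite setDS ?subsetUr.
by exists v; rewrite !inE ?eqxx ?vA.
Qed.

Lemma dom_connect_union (m : nat) (G : sgraph) (A B : dom_graph m G) :
  #|val A :|: val B| <= m -> connect (@adj (dom_graph m G)) A B.
Proof.
move=> leU; have /andP[domA _] := valP A.
pose U := dom_set (subset_dominating (subsetUl _ _) domA) leU.
apply: (connect_trans (y := U)); first exact/dom_connect_subset/subsetUl.
by rewrite dom_connect_sym; exact/dom_connect_subset/subsetUr.
Qed.

(** * The graph and its dominating sets *)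

Section Construction.

Variables k r : nat.

(* [inl None] is [w], [inl (Some i)] is [x_i] and [inr (i, j)] is [y_ij]. *)
Definition kr_vertex : finType := (option 'I_k + 'I_k * 'I_r)%type.

Definition kr_adj : rel kr_vertex := fun u v =>
  match u, v with
  | inl a, inl b => a != b
  | inl a, inr (i, _) => a == Some i
  | inr (i, _), inl a => a == Some i
  | inr (i, j), inr (i', j') => (j == j') && (i != i')
  end.

Lemma kr_adj_sym : symmetric kr_adj.
Proof.
move=> [a|[i j]] [b|[i' j']] //=; first by rewrite eq_sym.
by rewrite eq_sym [i == _]eq_sym.
Qed.

Lemma kr_adj_irrefl : irreflexive kr_adj.
Proof. by move=> [a|[i j]] /=; rewrite !eqxx. Qed.

Definition kr_graph : sgraph := SGraph kr_adj_sym kr_adj_irrefl.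

Definition xset : {set kr_graph} := [set inl (Some i) | i : 'I_k].

Definition transversal (f : 'I_r -> 'I_k) : {set kr_graph} :=
  [set inr (f j, j) | j : 'I_r].

Definition selection (a : option 'I_k) (f : 'I_r -> 'I_k) : {set kr_graph} :=
  inl a |: transversal f.

Lemma card_xset : #|xset| = k.
Proof. by rewrite card_imset ?card_ord // => i j []. Qed.

Lemma card_transversal f : #|transversal f| = r.
Proof. by rewrite card_imset ?card_ord // => i j []. Qed.

Lemma card_selection a f : #|selection a f| = r.+1.
Proof. by rewrite cardsU1 card_transversal; case: imsetP => [[j _]|_]. Qed.

(** The index [i0] provides a neighbour of [w] in [xset], which would be empty for [k = 0]. *)
Lemma xset_dominating (i0 : 'I_k) : dominating xset.
Proof.
apply/forallP=> -[[i|]|[i j]]; apply/implyP=> vX.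
- by rewrite imset_f in vX.
- by apply/existsP; exists (inl (Some i0)); rewrite imset_f.
- by apply/existsP; exists (inl (Some i)); rewrite imset_f //= eqxx.
Qed.

Lemma selection_dominating a f : dominating (selection a f).
Proof.
apply/forallP=> -[b|[i j]]; apply/implyP=> vS; apply/existsP.
  exists (inl a); rewrite setU11 /=.
  by apply: contraNneq vS => ->; rewrite setU11.
exists (inr (f j, j)).
have fS : inr (f j, j) \in selection a f by rewrite setU1r // imset_f.
by rewrite fS /= eqxx; apply: contraNneq vS => <-.
Qed.

Lemma dominating_column (D : {set kr_graph}) (i : 'I_k) (j : 'I_r) :
  dominating D -> inl (Some i) \notin D -> exists i', inr (i', j) \in D.
Proof.
move=> /forallP domD xD; have [yD|yD] := boolP (inr (i, j) \in D).
  by exists i.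
have /existsP[[a|[i' j']] /andP[uD]] := implyP (domD (inr (i, j))) yD.
  by move=> /eqP ea; rewrite -ea uD in xD.
by move=> /andP[/eqP ej _]; exists i'; rewrite -ej.
Qed.

Lemma dominating_base (D : {set kr_graph}) :
  dominating D ->
  xset \subset D \/ exists a f, selection a f \subset D.
Proof.
move=> domD; have [sXD|/subsetPn[_ /imsetP[i _ ->] xD]] := boolP (xset \subset D).
  by left.
right; have [a aD] : exists a, inl a \in D.
  have [wD|wD] := boolP (inl None \in D); first by exists None.
  have /existsP[[a|[i' j]] /andP[uD //]] := implyP (forallP domD (inl None)) wD.
  by exists a.
have colD j : exists i', inr (i', j) \in D by apply: dominating_column xD.
exists a, (fun j => xchoose (colD j)).
rewrite subUset sub1set aD; apply/subsetP=> _ /imsetP[j _ ->].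
exact: xchooseP (colD j).
Qed.

(** A missing [x_i] forces [D] to meet all [r] columns, and these are disjoint from [xset]. This
    gives both the minimality of [xset] and the lower bound on [d_0]. *)
Lemma xset_exchange (D : {set kr_graph}) (i : 'I_k) :
  dominating D -> inl (Some i) \notin D -> r <= #|D :\: xset|.
Proof.
move=> domD xD.
have colD j : exists i', inr (i', j) \in D by apply: dominating_column xD.
rewrite -(card_transversal (fun j => xchoose (colD j))).
apply/subset_leq_card/subsetP=> _ /imsetP[j _ ->].
rewrite inE (xchooseP (colD j)) andbT.
by apply/imsetP=> -[].
Qed.

(** * Domination and upper domination numbers *)

Lemma kr_gamma : 0 < k -> r < k -> gamma kr_graph = r.+1.
Proof.
move=> k0 rk; pose i0 := Ordinal k0.
apply/eqP; rewrite eqn_leq; apply/andP; split.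
  rewrite -(card_selection None (fun=> i0)).
  exact/gamma_le/selection_dominating.
have [D /dominating_base[sXD|[a [f sSD]]] ->] := gamma_witness kr_graph.
  by rewrite (leq_trans rk) // -card_xset subset_leq_card.
by rewrite -(card_selection a f) subset_leq_card.
Qed.

Lemma xset_minset : 0 < k -> 0 < r -> minset (@dominating kr_graph) xset.
Proof.
move=> k0 r0; apply/minsetP; split=> [|D domD sDX].
  exact: (xset_dominating (Ordinal k0)).
apply/eqP; rewrite eqEsubset sDX /=; apply/subsetP=> _ /imsetP[i _ ->].
(* If [D] missed some [x_i], it would have at least [r > 0] elements outside [xset]. *)
apply: contraLR r0 => /(xset_exchange domD).
by rewrite (eqP (_ : D :\: xset == set0)) ?setD_eq0 // cards0 leqn0 => /eqP ->.
Qed.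

Lemma kr_Gamma : 0 < r -> r < k -> Gamma kr_graph = k.
Proof.
move=> r0 rk; have k0 := leq_ltn_trans (leq0n r) rk.
apply/eqP; rewrite eqn_leq; apply/andP; split; last first.
  rewrite -[X in X <= _]card_xset /Gamma.
  by apply: leq_bigmax_cond; apply: xset_minset.
apply/bigmax_leqP=> D /minsetP[domD minD].
have [sXD|[a [f sSD]]] := dominating_base domD.
  by rewrite -(minD _ (xset_dominating (Ordinal k0)) sXD) card_xset.
by rewrite -(minD _ (selection_dominating a f) sSD) card_selection.
Qed.

(** * Connectedness from [k + r] on, and its failure just below *)

Lemma kr_connected m :
  0 < r -> r < k -> k + r <= m -> connected (dom_graph m kr_graph).
Proof.
move=> r0 rk krm; have k0 := leq_ltn_trans (leq0n r) rk.
pose i0 := Ordinal k0; pose f0 (_ : 'I_r) := i0.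
have ltrm : r < m by rewrite (leq_trans rk) // (leq_trans (leq_addr r k)).
have leS a f : #|selection a f| <= m by rewrite card_selection.
have leX : #|xset| <= m by rewrite card_xset (leq_trans (leq_addr r k)).
pose S a f := dom_set (selection_dominating a f) (leS a f).
pose X := dom_set (xset_dominating i0) leX.
pose Z := S (Some i0) f0.
have XZ : connect (@adj (dom_graph m kr_graph)) X Z.
  (* [Z] meets the first clique in [x_i0], which already lies in [X], so the union has at most
     [k + r] elements; with [w] instead it would have one more. *)
  apply: dom_connect_union => /=.
  have x0X : [set inl (Some i0)] \subset xset by rewrite sub1set imset_f.
  rewrite /selection setUA (setUidPl x0X).
  rewrite (leq_trans (leq_card_setU _ _)) //.
  by rewrite card_xset card_transversal.
have SZ a f : connect (@adj (dom_graph m kr_graph)) (S a f) Z.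
  (* Change the column vertices first, then the clique vertex. The two unions have at most
     [1 + r + r] and [2 + r] elements, both at most [k + r] since [1 <= r < k]. *)
  apply: (connect_trans (y := S a f0)); apply: dom_connect_union => /=.
    rewrite /selection -setUUr (leq_trans (leq_card_setU _ _)) // cards1 add1n.
    rewrite (leq_ltn_trans (leq_card_setU _ _)) // !card_transversal.
    by rewrite (leq_trans _ krm) // ltn_add2r.
  rewrite /selection -setUUl (leq_trans (leq_card_setU _ _)) //.
  rewrite card_transversal (leq_trans _ krm) // leq_add2r.
  rewrite (leq_trans (leq_card_setU _ _)) // !cards1.
  exact: leq_ltn_trans r0 rk.
have toZ A : connect (@adj (dom_graph m kr_graph)) A Z.
  have /andP[domA _] := valP A.
  have [sXA|[a [f sSA]]] := dominating_base domA.
    apply: connect_trans XZ; rewrite dom_connect_sym.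
    exact: dom_connect_subset.
  apply: connect_trans (SZ a f); rewrite dom_connect_sym.
  exact: dom_connect_subset.
apply/andP; split; first by apply/card_gt0P; exists Z.
apply/forallP=> A; apply/forallP=> B.
by apply: connect_trans (toZ A) _; rewrite dom_connect_sym.
Qed.

Lemma kr_disconnected :
  0 < r -> r < k -> ~~ connected (dom_graph (k + r).-1 kr_graph).
Proof.
move=> r0 rk; have k0 := leq_ltn_trans (leq0n r) rk.
pose i0 := Ordinal k0; pose m := (k + r).-1.
have mS : m.+1 = k + r by rewrite prednK // addn_gt0 k0.
have lekm : k <= m by rewrite -ltnS mS -addn1 leq_add2l.
have leS : #|selection None (fun=> i0)| <= m.
  by rewrite card_selection (leq_trans rk).
have leX : #|xset| <= m by rewrite card_xset.
pose S := dom_set (selection_dominating None (fun=> i0)) leS.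
pose X := dom_set (xset_dominating i0) leX.
(* Containing [xset] is invariant along edges, and it separates [X] from [S]. *)
pose supX := [pred A : dom_graph m kr_graph | xset \subset val A].
have step (A B : dom_graph m kr_graph) : adj A B -> A \in supX -> B \in supX.
  rewrite !inE => AB sXA.
  case/existsP: AB => v /orP[] /andP[vA /eqP eB].
    by rewrite eB (subset_trans sXA) ?subsetUr.
  apply/subsetP=> _ /imsetP[i _ ->].
  have /andP[domB _] := valP B; have /andP[_ leA] := valP A.
  (* If deleting [v] loses some [x_i], then [B] has at least [r] elements outside [xset]. So does
     [A], which also contains [xset] and hence has at least [k + r > m] elements. *)
  apply: contraLR leA => xB; rewrite -ltnNge mS.
  rewrite -(cardsID xset (val A)) (setIidPr sXA) card_xset leq_add2l.
  apply: leq_trans (xset_exchange domB xB) _.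
  by rewrite subset_leq_card // eB setSD // subsetDl.
have clX : closed (@adj (dom_graph m kr_graph)) supX.
  move=> A B AB; apply/idP/idP; first exact: step.
  by apply: step; rewrite adj_sym.
apply/negP => /andP[_ /forallP/(_ X)/forallP/(_ S)/(closed_connect clX)].
(* [S] meets the first clique only in [w], so it misses [x_i0]. *)
rewrite !inE subxx => /esym/subsetP/(_ (inl (Some i0))).
rewrite imset_f // => /(_ isT); rewrite !inE /=.
by case/imsetP.
Qed.

Lemma kr_d0 : 0 < r -> r < k -> is_d0 kr_graph (k + r).
Proof.
move=> r0 rk; split=> [m|d' conn]; first exact: kr_connected.
rewrite leqNgt; apply/negP=> ltd; have := kr_disconnected r0 rk.
by rewrite conn // -ltnS prednK // addn_gt0 r0 orbT.
Qed.

End Construction.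

Theorem theorem1 (k r : nat) (hk : 3 <= k) (hr1 : 1 <= r) (hr2 : r <= k - 1) :
  exists G : sgraph,
    [/\ Gamma G = k,
        gamma G = r + 1,
        is_d0 G (k + r) &
        k + r = Gamma G + gamma G - 1].
Proof.
have k0 : 0 < k by apply: leq_trans hk.
have rk : r < k by rewrite -(prednK k0) ltnS -subn1.
exists (kr_graph k r).
rewrite kr_Gamma // kr_gamma // addn1 addnS subn1.
by split=> //; exact: kr_d0.
Qed.
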